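(* Let $n$ be a nonnegative integer and let $\pi_1,\pi_2,\ldots,\pi_{2n}$ be a sequence of $2n$ distinct integers. Then there exists a unique $k\in\{0,1,\ldots,n\}$ such that all the cycle lengths of both permutations \[ \Phi^{-1}(\pi_{2k}, \pi_{2k-1}, \ldots, \pi_2,\pi_1) \qquad\text{and}\qquad \Phi^{-1}(\pi_{2k+1}, \pi_{2k+2}, \ldots, \pi_{2n-1},\pi_{2n}) \] are even.
   Context: For a finite set $S$ of integers, $\Phi$ denotes the following map from permutations of $S$ (bijections $S\to S$) to linear orderings of $S$ (sequences listing each element of $S$ exactly once). Given a permutation $\pi$ of $S$, write $\pi$ in disjoint cycle notation (fixed points included as cycles of length $1$), such that in each cycle the largest element of the cycle is written first, and the cycles themselves are arranged in increasing order of their largest elements. Then erase the parentheses to obtain the sequence $\Phi(\pi)$. The map $\Phi$ is a bijection: the beginnings of the cycles are recovered as the records (left-to-right maxima) of $\Phi(\pi)$, i.e. the entries that are larger than all entries preceding them (the first entry is always a record). Thus for any sequence $\rho$ of distinct integers, $\Phi^{-1}(\rho)$ is a well-defined permutation of the set of entries of $\rho$. For example, if $S=\{2,3,5,6,7,9\}$ and $\pi=(5,2)(7)(9,3,6)$, then $\Phi(\pi)=5,2,7,9,3,6$. When $k=0$ the first sequence is empty, and when $k=n$ the second sequence is empty; $\Phi^{-1}$ of the empty sequence is the empty permutation, which has no cycles, so the condition on it holds vacuously. *)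

(* Defs.v *)
From HB Require Import structures.
From mathcomp Require Import all_boot all_order all_algebra all_fingroup.
From mathcomp Require Import finmap.

Set Implicit Arguments.
Unset Strict Implicit.
Unset Printing Implicit Defensive.

Import Order.TTheory GRing.Theory Num.Theory.

Definition cycle_max (S : {fset int}) (sigma : {perm S}) (x : S) : bool :=
  [forall y in porbit sigma x, (val y <= val x)%R].

(* The cycle through x, written x, sigma x, sigma (sigma x), ...;
   fixed points are cycles of length 1. *)
Definition cycle_word (S : {fset int}) (sigma : {perm S}) (x : S) : seq int :=
  [seq val y | y <- traject sigma x #|porbit sigma x|].

Definition cycle_maxima (S : {fset int}) (sigma : {perm S}) : seq S :=
  sort (fun x y : S => (val x <= val y)%R)
       [seq x <- enum {: S} | cycle_max sigma x].

Definition Phi (S : {fset int}) (sigma : {perm S}) : seq int :=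
  flatten [seq cycle_word sigma x | x <- cycle_maxima sigma].

(* The default value 1 is never used when rho has distinct entries: in that case
   Phi_inv rho is the unique permutation of the set of entries of rho that Phi
   sends to rho, by Phi_invK and Phi_inj below. *)
Definition Phi_inv (rho : seq int) : {perm [fset x in rho]%fset} :=
  odflt 1%g [pick sigma : {perm [fset x in rho]%fset} | Phi sigma == rho].

Definition even_cycles (S : {fset int}) (sigma : {perm S}) : bool :=
  [forall C in porbits sigma, ~~ odd #|C|].

Section PhiBijective.

Variable S : {fset int}.
Implicit Types (sigma tau : {perm S}) (x y m : S).

Let le : rel S := fun x y => (val x <= val y)%R.

Let le_trans : transitive le. Proof. by move=> y x z; apply: Order.POrderTheory.le_trans. Qed.
Let le_total : total le. Proof. by move=> x y; apply: Order.TotalTheory.le_total. Qed.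
Let le_anti : antisymmetric le.
Proof. by move=> x y /Order.POrderTheory.le_anti /val_inj. Qed.

Let word sigma x : seq S := traject sigma x #|porbit sigma x|.

Let words sigma (l : seq S) : seq S := flatten [seq word sigma x | x <- l].

Let PhiE sigma : Phi sigma = [seq val y | y <- words sigma (cycle_maxima sigma)].
Proof. by rewrite /Phi /words map_flatten -map_comp. Qed.

Let mem_maxima sigma x : (x \in cycle_maxima sigma) = cycle_max sigma x.
Proof. by rewrite mem_sort mem_filter mem_enum andbT. Qed.

Let uniq_maxima sigma : uniq (cycle_maxima sigma).
Proof. by rewrite sort_uniq filter_uniq // enum_uniq. Qed.

Let ex_max sigma x : exists2 m, cycle_max sigma m & x \in porbit sigma m.
Proof.
pose m := [arg max_(y > x in porbit sigma x) (val y)]%O.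
have [mx mmax] : m \in porbit sigma x /\ forall y, y \in porbit sigma x -> le y m.
  rewrite /m; case: Order.TotalTheory.arg_maxP => [|i xi imax]; first exact: porbit_id.
  by split=> // y /imax.
have Em : porbit sigma m = porbit sigma x by apply/eqP; rewrite eq_porbit_mem.
exists m; last by rewrite porbit_sym.
by apply/forall_inP => y; rewrite Em => /mmax.
Qed.

Let max_inj sigma m1 m2 :
  cycle_max sigma m1 -> cycle_max sigma m2 -> m1 \in porbit sigma m2 -> m1 = m2.
Proof.
move=> /forall_inP h1 /forall_inP h2 h; apply: le_anti.
by apply/andP; split; [apply: h2 | apply: h1; rewrite porbit_sym].
Qed.

Let mem_words sigma l y :
  reflect (exists2 m, m \in l & y \in porbit sigma m) (y \in words sigma l).
Proof.
apply: (iffP flatten_mapP) => -[m ml]; exists m => //.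
  by rewrite porbit_traject.
by rewrite -porbit_traject.
Qed.

Let uniq_words sigma l :
  uniq l -> {in l, forall m, cycle_max sigma m} -> uniq (words sigma l).
Proof.
elim: l => //= m l IH /andP[ml ul] lmax.
have {}IH : uniq (words sigma l).
  by apply: IH => // x xl; apply: lmax; rewrite inE xl orbT.
rewrite /words /= cat_uniq uniq_traject_porbit IH andbT /=.
apply/hasPn => y /mem_words[m' m'l ym']; apply/negP => /=.
rewrite -porbit_traject -eq_porbit_mem => /eqP E.
move: ym'; rewrite -eq_porbit_mem E eq_porbit_mem => mm'.
suff Em : m = m' by move: ml; rewrite Em m'l.
by apply: max_inj mm'; apply: lmax; rewrite inE ?eqxx ?m'l ?orbT.
Qed.

Let uniq_W sigma : uniq (words sigma (cycle_maxima sigma)).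
Proof. by apply: uniq_words => // m; rewrite mem_maxima. Qed.

Let mem_W sigma x : x \in words sigma (cycle_maxima sigma).
Proof.
by have [m mmax xm] := ex_max sigma x; apply/mem_words; exists m; rewrite ?mem_maxima.
Qed.

Lemma Phi_uniq sigma : uniq (Phi sigma).
Proof. by rewrite PhiE (map_inj_uniq val_inj). Qed.

Lemma mem_Phi sigma : Phi sigma =i S.
Proof.
move=> a; rewrite PhiE; apply/mapP/idP => [[x _ ->]|aS]; first exact: valP.
by exists [` aS]%fset.
Qed.

Let next (m : S) (q : seq S) : S :=
  if q is y :: _ then if le m y then m else y else m.

Let follows (w : seq S) x z : Prop := exists p q m,
  [/\ w = p ++ x :: q, m \in rcons p x, {in rcons p x, forall y, le y m}
    & z = next m q].

Let follows_fun w x z1 z2 :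
  uniq w -> follows w x z1 -> follows w x z2 -> z1 = z2.
Proof.
move=> uw [p1 [q1 [m1 [E1 m1p m1max ->]]]] [p2 [q2 [m2 [E2 m2p m2max ->]]]].
have ind p q : w = p ++ x :: q -> index x w = size p.
  move=> E; move: uw; rewrite E cat_uniq => /and3P[_ /hasPn h _].
  have xp : x \notin p by apply: h; rewrite inE eqxx.
  by rewrite index_cat (negbTE xp) /= eqxx addn0.
have sE : size p1 = size p2 by rewrite -(ind _ _ E1) (ind _ _ E2).
have /andP[/eqP Ep /eqP[Eq]] : (p1 == p2) && (x :: q1 == x :: q2).
  by rewrite -eqseq_cat // -E1 -E2.
subst p2 q2; congr (next _ q1).
by apply: le_anti; rewrite m2max // m1max.
Qed.

Let follows_Phi sigma x :
  follows (words sigma (cycle_maxima sigma)) x (sigma x).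
Proof.
have [m mmax xm] := ex_max sigma x.
have mE := mem_maxima sigma.
have mms : m \in cycle_maxima sigma by rewrite mE.
have := uniq_maxima sigma.
have : sorted le (cycle_maxima sigma) by apply: sort_sorted le_total _.
have {mE} : {in cycle_maxima sigma, forall m, cycle_max sigma m}.
  by move=> y; rewrite mE.
case/splitPr: mms => l1 l2 lmax srt unq.
have l1m y : y \in l1 -> le y m.
  by move=> yl; move: srt; rewrite (sorted_pairwise le_trans) pairwise_cat => /and3P[/allrelP h _ _]; apply: h; rewrite ?inE ?eqxx.
have ml2 y : y \in l2 -> le m y.
  move=> yl; move: srt; rewrite (sorted_pairwise le_trans) pairwise_cat /= => /and4P[_ _ /allP h _].
  exact: h.
have npos : 0 < #|porbit sigma m| by rewrite lt0n card_porbit_neq0.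
have: x \in word sigma m by rewrite -porbit_traject.
have tin : forall y, y \in word sigma m -> le y m.
  by move=> y; rewrite -porbit_traject => ym; have /forall_inP := mmax; apply.
have : fpath sigma m (behead (word sigma m)).
  by rewrite /word; case: #|_| npos => //= k _; apply: fpath_traject.
have : uniq (word sigma m) by apply: uniq_traject_porbit.
have : head x (word sigma m) = m by rewrite /word; case: #|_| npos.
have : sigma (last x (word sigma m)) = m.
  rewrite -[RHS](iter_porbit sigma m) /word.
  by case: #|_| npos => // k _; rewrite trajectS /= last_traject.
rewrite /words map_cat flatten_cat /=.
move: (word sigma m) tin => t tin lastt headt ut ft xt.
case/splitPr: xt tin lastt headt ut ft => a b tin lastt headt ut ft.
exists (flatten [seq word sigma x | x <- l1] ++ a).
exists (b ++ flatten [seq word sigma x | x <- l2]), m; split.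
- by rewrite -!catA.
- rewrite rcons_cat mem_cat; case: a headt {lastt ut ft tin} => /= [->|y a ->].
    by rewrite inE eqxx orbT.
  by rewrite inE eqxx orbT.
- move=> y; rewrite rcons_cat mem_cat => /orP[/mem_words[m' m'l1 ym']|ya].
    apply: (le_trans (y := m')); last exact: l1m.
    have /forall_inP : cycle_max sigma m' by apply: lmax; rewrite mem_cat m'l1.
    exact.
  by apply: tin; rewrite -cat_rcons mem_cat ya.
case: b lastt ut ft tin headt => [|y b] /= lastt ut ft tin headt.
  rewrite last_cat /= in lastt; rewrite lastt.
  case: l2 ml2 {lmax srt unq} => //= m' l2 ml2.
  rewrite /word; case E: #|_| => [|k]; last by rewrite /= ml2 ?inE ?eqxx.
  by move/eqP: E; rewrite (negbTE (card_porbit_neq0 _ _)).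
have -> : sigma x = y.
  case: a ft headt {ut tin lastt} => /= [+ ->|z a + _]; first by case/andP => /eqP.
  by rewrite cat_path /= => /and4P[_ _ /eqP ->].
case: ifP => // my.
have ym : y = m.
  apply: le_anti; rewrite my andbT; apply: tin.
  by rewrite mem_cat !inE eqxx !orbT.
move: ut headt; rewrite ym; case: a {ft tin lastt} => /= [|z a].
  by move=> + E; rewrite E inE eqxx.
by move=> + E; rewrite E mem_cat !inE eqxx !orbT.
Qed.

Lemma Phi_inj : injective (@Phi S).
Proof.
move=> sigma tau; rewrite !PhiE => /(inj_map val_inj) E.
apply/permP => x; apply: follows_fun (follows_Phi sigma x) _ => //.
by rewrite E.
Qed.

Lemma Phi_surj (rho : seq int) :
  uniq rho -> rho =i S -> exists sigma, Phi sigma = rho.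
Proof.
move=> urho rhoS.
pose im := [seq Phi sigma | sigma <- enum {: {perm S}}].
have uim : uniq im by rewrite (map_inj_uniq Phi_inj) enum_uniq.
have sub : {subset im <= permutations rho}.
  move=> _ /mapP[sigma _ ->]; rewrite mem_permutations uniq_perm ?Phi_uniq //.
  by move=> a; rewrite mem_Phi rhoS.
have Sc : size rho = #|{: S}|.
  rewrite -cardfE; apply/perm_size/uniq_perm => //; exact: fset_uniq.
have [|_ E] := uniq_min_size uim sub.
  rewrite size_permutations // size_map -cardE Sc.
  have := card_perm [set: S]; rewrite cardsT => <-.
  apply: subset_leq_card; apply/subsetP => s _; exact: isT.
have : rho \in im by rewrite E mem_permutations.
by case/mapP => sigma _ ->; exists sigma.
Qed.

End PhiBijective.

Lemma Phi_invK (rho : seq int) : uniq rho -> Phi (Phi_inv rho) = rho.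
Proof.
move=> urho; rewrite /Phi_inv; case: pickP => [sigma /eqP //|none].
have [|sigma /eqP] := @Phi_surj [fset x in rho]%fset rho urho.
  by move=> a; rewrite in_fset.
by rewrite none.
Qed.

(* Main.v *)
Require Import Defs.
From mathcomp Require Import all_boot all_order all_algebra all_fingroup.
From mathcomp Require Import finmap.
From mathcomp Require Import zify.

(** A permutation has only even cycles exactly when the word [Phi sigma] has
    even length and all its records sit at even (0-based) positions: the records
    are the first letters of the cycles ([even_cycles_Phi]).  So one has to show
    that a word [s] of even length with distinct letters has a unique cut at an
    even place [2 * k] such that both halves, read outwards from the cut, have
    their records at even positions.

    Write [s = u ++ x :: v] with [x] the largest letter.  Read from the cut, [x]
    is always a record, and nothing beyond it is.  If [size u] is even, then the
    cut must lie in [u], since otherwise [x] would be at an odd position of the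
    left half; once it does, the conditions say precisely that it is a good cut of
    [u] ([even_split_max_even]).  If [size u] is odd, then symmetrically the
    cut must lie in [v] and be a good cut of [v] ([even_split_max_odd]).  In both
    cases the remaining word has even length, and existence and uniqueness follow
    together by induction on the length ([even_split_unique]). *)

Set Implicit Arguments.
Unset Strict Implicit.
Unset Printing Implicit Defensive.

Import Order.TTheory.

Lemma drop_cat_le (T : Type) (s1 s2 : seq T) n :
  n <= size s1 -> drop n (s1 ++ s2) = drop n s1 ++ s2.
Proof.
rewrite drop_cat; case: ltngtP => // -> _.
by rewrite subnn drop0 drop_size.
Qed.

Section EvenRecords.

Context {d : Order.disp_t} {T : orderType d}.
Implicit Types (s u v : seq T) (x : T).

(** All records (left-to-right maxima) of [s] are at even 0-based positions.
    The default value [x0] of [nth] is quantified so as not to require an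
    inhabitant of [T]; it is never read. *)
Definition even_records s : Prop := forall x0 i, i < size s ->
  all (fun y => y < nth x0 s i)%O (take i s) -> ~~ odd i.

(** Cutting [s] at the even place [2 * k] gives two words whose records, read
    outwards from the cut, are all at even positions. *)
Definition even_split s k : Prop :=
  [/\ 2 * k <= size s, even_records (rev (take (2 * k) s))
    & even_records (drop (2 * k) s)].

(** Whether the records are at even positions is decided by the word up to and
    including its maximum. *)
Lemma even_records_max u x v :
  all (fun y => y < x)%O u -> all (fun y => y < x)%O v ->
  even_records (u ++ x :: v) <-> even_records u /\ ~~ odd (size u).
Proof.
move=> ux vx; split=> [H|[Hu ou] x0 i].
  split=> [x0 i iu rec|].
    apply: (H x0 i); first by rewrite size_cat; lia.
    by rewrite nth_cat iu takel_cat // ltnW.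
  apply: (H x); first by rewrite size_cat /=; lia.
  by rewrite nth_cat ltnn subnn take_size_cat.
rewrite size_cat /= nth_cat take_cat => ilt.
case: ltngtP => [iu|ui|-> //]; first exact: Hu.
(* beyond [x], no letter can exceed the letter [x] that precedes it *)
have -> : i - size u = (i - size u).-1.+1 by lia.
rewrite all_cat /= => /and3P[_ xlt _].
have /(all_nthP x0)/(_ (i - size u).-1) := vx.
by move=> /(_ ltac:(lia)) /(lt_trans xlt); rewrite ltxx.
Qed.

Lemma uniq_max_split s : uniq s -> 0 < size s ->
  exists u x v, [/\ s = u ++ x :: v, all (fun y => y < x)%O u
                  & all (fun y => y < x)%O v].
Proof.
elim: s => // a [|b t] IH /andP[ai us] _; first by exists [::], a, [::].
have [u [x [v [E ux vx]]]] := IH us isT.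
rewrite E in ai *; have : a != x.
  by apply: contraNneq ai => ->; rewrite mem_cat inE eqxx orbT.
case: ltgtP => // [ax|xa] _.
  by exists (a :: u), x, v; split=> //=; rewrite ax.
exists [::], a, (u ++ x :: v); split=> //.
rewrite all_cat /= xa /=; apply/andP.
by split; [apply: sub_all ux | apply: sub_all vx] => y yx; apply: lt_trans xa.
Qed.

Lemma even_split_max_even u x v k :
  all (fun y => y < x)%O u -> all (fun y => y < x)%O v -> ~~ odd (size u) ->
  even_split (u ++ x :: v) k <-> even_split u k.
Proof.
move=> ux vx ou; rewrite /even_split size_cat /=.
have [ku|uk] := leqP (2 * k) (size u).
  have dx : all (fun y => y < x)%O (drop (2 * k) u).
    by apply/allP => y /mem_drop; apply: (allP ux).
  rewrite takel_cat // drop_cat_le //.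
  split=> [[_ H1 /even_records_max [] //]|[_ H1 H2]]; split=> //.
    by lia.
  by apply/even_records_max => //; split=> //; rewrite size_drop; lia.
split=> [[ks + _]|[]]; last by lia.
have -> : take (2 * k) (u ++ x :: v) = u ++ x :: take (2 * k - size u).-1 v.
  rewrite take_cat ltnNge ltnW //=.
  by have {1}-> : 2 * k - size u = (2 * k - size u).-1.+1 by lia.
rewrite rev_cat rev_cons cat_rcons => /even_records_max[].
- by rewrite all_rev; apply/allP => y /mem_take; apply: (allP vx).
- by rewrite all_rev.
- by move=> _; rewrite size_rev size_takel; lia.
Qed.

Lemma even_split_max_odd u x v k :
  all (fun y => y < x)%O u -> all (fun y => y < x)%O v -> odd (size u) ->
  even_split (u ++ x :: v) k <->
  uphalf (size u) <= k /\ even_split v (k - uphalf (size u)).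
Proof.
move=> ux vx ou; rewrite /even_split size_cat /=.
have uE : 2 * uphalf (size u) = (size u).+1 by lia.
have [ku|uk] := leqP (2 * k) (size u).
  split=> [[_ _]|[]]; last by lia.
  rewrite drop_cat_le // => /even_records_max[] //.
    by apply/allP => y /mem_drop; apply: (allP ux).
  by move=> _; rewrite size_drop; lia.
have kE : 2 * k - size u = (2 * (k - uphalf (size u))).+1 by lia.
rewrite take_cat drop_cat (ltnNge (2 * k)) (ltnW uk) /= kE /= rev_cat rev_cons cat_rcons.
set j := k - uphalf (size u) in kE *.
have tx : all (fun y => y < x)%O (rev (take (2 * j) v)).
  by rewrite all_rev; apply/allP => y /mem_take; apply: (allP vx).
have xu : all (fun y => y < x)%O (rev u) by rewrite all_rev.
have recE := even_records_max tx xu.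
split=> [[ks /recE[H1 _] H2]|[uk' [jv H1 H2]]].
  by split; [lia|split=> //; lia].
split=> //; first by lia.
by apply/recE; split=> //; rewrite size_rev size_takel //; lia.
Qed.

Theorem even_split_unique s :
  uniq s -> ~~ odd (size s) -> exists! k, even_split s k.
Proof.
have [m] := ubnP (size s); elim: m s => // m IH s sm us os.
have [s0|] := posnP (size s).
  rewrite (size0nil s0); exists 0; split=> [|k []]; last by rewrite /=; lia.
  by split=> //= x0 i.
move=> /(uniq_max_split us)[u [x [v [E ux vx]]]].
move: sm us os; rewrite {}E size_cat cat_uniq /= => sm /and4P[uu _ _ uv] os.
have [ou|eu] := boolP (odd (size u)).
  have [||j [jv juniq]] := IH v _ uv; try by lia.
  exists (j + uphalf (size u)); split=> [|k /even_split_max_odd[] // uk /juniq ->].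
    by apply/even_split_max_odd => //; rewrite addnK leq_addl.
  by rewrite subnK.
have [||j [jv juniq]] := IH u _ uu; try by lia.
exists j; split=> [|k /even_split_max_even kk]; first exact/even_split_max_even.
by apply: juniq; apply: kk.
Qed.

End EvenRecords.

Section EvenCycles.

Variables (S : {fset int}) (sigma : {perm S}).
Implicit Types (x y m : S).

Lemma porbit_cycle_max x :
  exists2 m, cycle_max sigma m & porbit sigma x = porbit sigma m.
Proof.
have [m mx mmax] :
    exists2 m, m \in porbit sigma x &
      forall y, y \in porbit sigma x -> (val y <= val m)%O.
  have [m mx mmax] := @arg_maxP _ _ _ x (mem (porbit sigma x)) val
    (porbit_id sigma x).
  by exists m.
have E : porbit sigma m = porbit sigma x by apply/eqP; rewrite eq_porbit_mem.
by exists m => //; apply/forall_inP => y; rewrite E => /mmax.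
Qed.

Lemma cycle_word_max m : cycle_max sigma m ->
  exists2 w, cycle_word sigma m = val m :: w & all (fun a => a < val m)%O w.
Proof.
move=> /forall_inP mmax; have := uniq_traject_porbit sigma m.
have := porbit_traject sigma m; rewrite /cycle_word.
have : 0 < #|porbit sigma m| by rewrite lt0n card_porbit_neq0.
case: #|_| => //= k _ tE /andP[mt _].
exists [seq val y | y <- traject sigma (sigma m) k] => //.
rewrite all_map; apply/allP => y yt /=; rewrite lt_neqAle.
have ym : y \in porbit sigma m by rewrite tE inE yt orbT.
rewrite [(_ <= _)%O]mmax // andbT.
by apply: contraNneq mt => /val_inj Eym; rewrite -{1}Eym.
Qed.

Lemma size_cycle_word m : size (cycle_word sigma m) = #|porbit sigma m|.
Proof. by rewrite size_map size_traject. Qed.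

(** By induction on the list of cycles, adding the cycle with the largest
    maximum at the end: that maximum is then the maximum of the whole word. *)
Lemma even_records_cycle_words (l : seq S) :
  pairwise (fun x y => val x < val y)%O l -> all (cycle_max sigma) l ->
  let w := flatten [seq cycle_word sigma x | x <- l] in
  even_records w /\ ~~ odd (size w)
    <-> all (fun x => ~~ odd #|porbit sigma x|) l.
Proof.
elim/last_ind: l => [|l m IH] /=; first by split=> // _; split=> // x0 i.
rewrite pairwise_rcons !all_rcons => /andP[lm lp] /andP[mmax lmax].
rewrite map_rcons flatten_rcons -(size_cycle_word m).
have {IH} := IH lp lmax; set u := flatten _ => /= IH.
have [w -> wm] := cycle_word_max mmax.
have um : all (fun a => a < val m)%O u.
  apply/allP => a /flatten_mapP[x xl].
  have [w' -> w'x] := cycle_word_max (allP lmax _ xl).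
  have xm : (val x < val m)%O := allP lm _ xl.
  rewrite inE => /predU1P[->|/(allP w'x)/lt_trans]; first exact: xm.
  by apply.
rewrite size_cat /=; split=> [[/even_records_max[] // Hu ou o]|/andP[ow Hl]].
  by apply/andP; split; [lia|apply/IH].
have [Hu ou] := IH.2 Hl.
by split; [apply/even_records_max|lia].
Qed.

(** The even positions of the records account for all cycles but the last one,
    whose length is then even exactly when the total length is. *)
Lemma even_cycles_Phi :
  even_cycles sigma <-> even_records (Phi sigma) /\ ~~ odd (size (Phi sigma)).
Proof.
have mE m : (m \in cycle_maxima sigma) = cycle_max sigma m.
  by rewrite mem_sort mem_filter mem_enum andbT.
rewrite /Phi even_records_cycle_words; first last.
- by apply/allP => m; rewrite mE.
- have le_trans : transitive (fun x y : S => val x <= val y)%O.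
    by move=> y x z; apply: le_trans.
  have : sorted (fun x y : S => val x <= val y)%O (cycle_maxima sigma).
    by apply: sort_sorted => x y; apply: le_total.
  have : uniq (cycle_maxima sigma) by rewrite sort_uniq filter_uniq ?enum_uniq.
  rewrite (sorted_pairwise le_trans) uniq_pairwise => ne le.
  have := conj ne le => /andP; rewrite -pairwise_relI.
  apply: sub_pairwise => x y /andP[xy]; rewrite lt_neqAle => -> /=.
  by rewrite andbT (inj_eq val_inj).
split=> [/forall_inP ev|/allP ev].
  by apply/allP => m _; apply: ev; apply: imset_f.
apply/forall_inP => _ /imsetP[x _ ->].
by have [m mmax ->] := porbit_cycle_max x; apply: ev; rewrite mE.
Qed.

End EvenCycles.

Lemma even_cycles_Phi_inv (rho : seq int) : uniq rho -> ~~ odd (size rho) ->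
  even_cycles (Phi_inv rho) <-> even_records rho.
Proof.
by move=> urho orho; rewrite even_cycles_Phi Phi_invK //; split=> [[]|].
Qed.

Theorem theorem1 (n : nat) (s : seq int)
    (size_s : size s = 2 * n) (uniq_s : uniq s) :
  exists! k : nat,
    [/\ k <= n,
        even_cycles (Phi_inv (rev (take (2 * k) s)))
      & even_cycles (Phi_inv (drop (2 * k) s))].
Proof.
have splitE k : [/\ k <= n, even_cycles (Phi_inv (rev (take (2 * k) s)))
    & even_cycles (Phi_inv (drop (2 * k) s))] <-> even_split s k.
  rewrite /even_split size_s leq_pmul2l //.
  have [kn|nk] := leqP k n; last by split=> -[].
  have evL : even_cycles (Phi_inv (rev (take (2 * k) s)))
      <-> even_records (rev (take (2 * k) s)).
    apply: even_cycles_Phi_inv; rewrite ?rev_uniq ?take_uniq //.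
    by rewrite size_rev size_takel ?size_s; lia.
  have evR : even_cycles (Phi_inv (drop (2 * k) s))
      <-> even_records (drop (2 * k) s).
    by apply: even_cycles_Phi_inv; rewrite ?drop_uniq // size_drop size_s; lia.
  by split=> -[_ /evL ? /evR ?].
have [|k [ks kuniq]] := even_split_unique uniq_s.
  by rewrite size_s mul2n odd_double.
by exists k; split=> [|j /splitE/kuniq //]; apply/splitE.
Qed.
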